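(* Let $\eta,x,y,s,t$ be parameters satisfying the relation $xs=yt$. For any $a_1,b_1\in\{0,1\}$ and $a_2,a_3,b_2,b_3\in\mathbb{Z}_{\ge0}$, the following equality of rational functions holds: $$\sum_{l_1,l_2,l_3}W^{\mathsf s}_{t,s}(a_3,a_2;l_3,l_2)\,w^{\mathsf s*}_{\eta x;\eta s}(l_3,l_1;b_3,a_1)\,w^{\mathsf s*}_{y;t}(l_2,b_1;b_2,l_1)$$ $$=\sum_{l_1,l_2,l_3}w^{\mathsf s*}_{\eta y;\eta t}(a_2,l_1;l_2,a_1)\,w^{\mathsf s*}_{x;s}(a_3,b_1;l_3,l_1)\,W^{\mathsf s}_{t,s}(l_3,l_2;b_3,b_2),$$ where the sums are over $l_1\in\{0,1\}$ and $l_2,l_3\in\mathbb{Z}_{\ge0}$.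
   Context: $q$ is a fixed generic parameter, $(x;q)_n:=\prod_{i=1}^n(1-xq^{i-1})$, $(x;q)_0:=1$. For $i,j,k,l\in\mathbb{Z}_{\ge0}$, $$W^{\mathsf s}_{t,s}(i,j;k,l):=\mathbf{1}_{i+j=k+l}\,\mathbf{1}_{i\ge l}\,s^{2l}t^{-2l}\frac{(s^2/t^2;q)_{i-l}(t^2;q)_l}{(s^2;q)_i}\frac{(q;q)_i}{(q;q)_{i-l}(q;q)_l}.$$ For $i,k\in\mathbb{Z}_{\ge0}$ and $j,l\in\{0,1\}$, the dual weights $w^{\mathsf s*}_{u;s}(i,l;k,j)$ ($i$ bottom, $l$ right, $k$ top, $j$ left label) are, for $g\in\mathbb{Z}_{\ge0}$, $$w^{\mathsf s*}_{u;s}(g,0;g,0)=\frac{1-suq^g}{1-su},\qquad w^{\mathsf s*}_{u;s}(g,1;g+1,0)=\frac{-s^{-1}u(1-s^2q^g)}{1-su},$$ $$w^{\mathsf s*}_{u;s}(g,0;g-1,1)=\frac{1-q^g}{1-su},\qquad w^{\mathsf s*}_{u;s}(g,1;g,1)=\frac{q^g-s^{-1}u}{1-su},$$ and $w^{\mathsf s*}_{u;s}(i,l;k,j)=0$ in all other cases. *)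

(* Defs.v *)
From mathcomp Require Import all_boot all_algebra.
From mathcomp Require Export boolp classical_sets cardinality fsbigop.

Set Implicit Arguments.
Unset Strict Implicit.
Unset Printing Implicit Defensive.

Import GRing.Theory.
Local Open Scope classical_set_scope.
Local Open Scope ring_scope.

Definition qpoch (F : fieldType) (q x : F) (n : nat) : F :=
  \prod_(i < n) (1 - x * q ^+ i).

Definition W (F : fieldType) (q t s : F) (i j k l : nat) : F :=
  if (i + j == k + l)%N && (l <= i)%N then
    s ^+ (2 * l) * t ^- (2 * l)
    * (qpoch q (s ^+ 2 / t ^+ 2) (i - l) * qpoch q (t ^+ 2) l
       / qpoch q (s ^+ 2) i)
    * (qpoch q q i / (qpoch q q (i - l) * qpoch q q l))
  else 0.

(* The {0,1}-valued labels are booleans. Argument order: [i] bottom, [l] right,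
   [k] top, [j] left. *)
Definition wdual (F : fieldType) (q u s : F)
    (i : nat) (l : bool) (k : nat) (j : bool) : F :=
  match l, j with
  | false, false =>
      if k == i then (1 - s * u * q ^+ i) / (1 - s * u) else 0
  | true, false =>
      if k == i.+1 then (- s^-1 * u * (1 - s ^+ 2 * q ^+ i)) / (1 - s * u)
      else 0
  | false, true =>
      if i == k.+1 then (1 - q ^+ i) / (1 - s * u) else 0
  | true, true =>
      if k == i then (q ^+ i - s^-1 * u) / (1 - s * u) else 0
  end.

(* Sums over infinite index sets are taken with [fsbigop], whose sums are 0 by
   convention on infinite supports. The conservation laws below make every
   support in the Yang-Baxter equation finite, so that convention never
   applies. *)
Lemma W_conserve (F : fieldType) (q t s : F) (i j k l : nat) :
  W q t s i j k l != 0 -> (i + j = k + l)%N.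
Proof. by rewrite /W; case: ifP; rewrite ?eqxx // => /andP[/eqP]. Qed.

Lemma wdual_conserve (F : fieldType) (q u s : F) (i k : nat) (l j : bool) :
  wdual q u s i l k j != 0 -> (i + l = k + j)%N.
Proof.
rewrite /wdual; case: l; case: j; case: ifP; rewrite ?eqxx //.
all: by move=> /eqP -> _; rewrite ?addn0 ?addn1.
Qed.

Lemma finite_support_bounded (F : fieldType) (N : nat)
    (f : bool * nat * nat -> F) :
  (forall l1 l2 l3, f (l1, l2, l3) != 0 -> (l2 < N)%N && (l3 < N)%N) ->
  finite_set [set p | f p != 0].
Proof.
move=> fN; apply: (@sub_finite_set _ _ (([set: bool] `*` `I_N) `*` `I_N)).
  by move=> [[l1 l2] l3] /= /fN /andP[].
apply: finite_setX; last exact: finite_II.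
by apply: finite_setX; [exact: finite_finset | exact: finite_II].
Qed.

Lemma finite_support_lhs (F : fieldType) (q eta x y s t : F)
    (a1 b1 : bool) (a2 a3 b2 b3 : nat) :
  finite_set [set p | (let: (l1, l2, l3) := p in
    W q t s a3 a2 l3 l2 * wdual q (eta * x) (eta * s) l3 l1 b3 a1
      * wdual q y t l2 b1 b2 l1) != 0].
Proof.
apply: (@finite_support_bounded _ (a3 + a2).+1) => l1 l2 l3.
rewrite !mulf_eq0 !negb_or => /andP[/andP[/W_conserve -> _] _].
by rewrite !ltnS leq_addl leq_addr.
Qed.

Lemma finite_support_rhs (F : fieldType) (q eta x y s t : F)
    (a1 b1 : bool) (a2 a3 b2 b3 : nat) :
  finite_set [set p | (let: (l1, l2, l3) := p in
    wdual q (eta * y) (eta * t) a2 l1 l2 a1 * wdual q x s a3 b1 l3 l1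
      * W q t s l3 l2 b3 b2) != 0].
Proof.
apply: (@finite_support_bounded _ (b3 + b2).+1) => l1 l2 l3.
rewrite !mulf_eq0 !negb_or => /andP[_ /W_conserve <-].
by rewrite !ltnS leq_addl leq_addr.
Qed.

(* Main.v *)
(* Conservation of labels leaves at most the two terms [l1 = 0, 1] on each side.
   After cancelling the common denominators [(1 - sx)(1 - eta^2 sx)], the weight
   [W(i, j; k, l)] is a coefficient depending only on [l] and [m = i - l], which
   obeys first-order recurrences in both. Writing every coefficient as a rational
   multiple of the one with smallest indices turns each of the four cases
   [(a1, b1)] into a rational identity in [q^l], [q^m], [q^a2]. *)
Require Import Defs.
From mathcomp Require Import all_boot all_algebra.
From mathcomp Require Import zify ring.
Import GRing.Theory.
Local Open Scope classical_set_scope.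
Local Open Scope ring_scope.

(** For sums in which conservation determines [l2] and [l3] from [l1]: the support lies on the graph
    of a function on the booleans. *)
Lemma fsum_two_points {F : fieldType} (g h : bool -> nat)
    (f : bool * nat * nat -> F) :
    (forall l1 l2 l3, f (l1, l2, l3) != 0 -> l2 = g l1 /\ l3 = h l1) ->
  \sum_(l \in [set: bool * nat * nat]) f l
    = f (false, g false, h false) + f (true, g true, h true).
Proof.
move=> supp.
rewrite (fsbigE [:: (false, g false, h false); (true, g true, h true)]) //=.
  by rewrite !big_cons big_nil !classical_sets.in_setT addr0.
move=> [[l1 l2] l3] _; apply: contraNeq => /supp[-> ->].
by case: l1; rewrite !inE eqxx ?orbT.
Qed.

Lemma qpochS {F : fieldType} (q x : F) (n : nat) :
  qpoch q x n.+1 = qpoch q x n * (1 - x * q ^+ n).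
Proof. by rewrite /qpoch big_ord_recr. Qed.

(** The q-Hahn (q-beta-binomial) weight of [l] out of [l + m] with parameters [S / T] and [S].
    Indexing by [m] instead of [i] avoids truncated subtraction. *)
Definition Wcoef {F : fieldType} (q T S : F) (l m : nat) : F :=
  (S / T) ^+ l * (qpoch q (S / T) m * qpoch q T l / qpoch q S (l + m))
  * (qpoch q q (l + m) / (qpoch q q m * qpoch q q l)).

(** The support conditions are equations naming [m], so a rewrite that fixes [m] leaves only linear
    arithmetic. *)
Lemma W_Wcoef {F : fieldType} (q t s : F) (i j k l m : nat) :
    i = (l + m)%N -> (m + j)%N = k ->
  W q t s i j k l = Wcoef q (t ^+ 2) (s ^+ 2) l m.
Proof.
move=> -> <-; rewrite /W /Wcoef leq_addr addKn.
by rewrite -addnA addnC eqxx /= !exprM -exprVn -exprMn.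
Qed.

Lemma W_gt {F : fieldType} (q t s : F) (i j k l : nat) :
  (i < l)%N -> W q t s i j k l = 0.
Proof. by rewrite /W ltnNge => /negbTE ->; rewrite andbF. Qed.

Section WcoefRecurrences.
Variables (F : fieldType) (q T S : F).
Hypothesis qn1 : forall n, 1 - q * q ^+ n != 0.
Hypothesis Sn1 : forall n, 1 - S * q ^+ n != 0.

Let qq_neq0 n : qpoch q q n != 0.
Proof. by apply/prodf_neq0 => i _; exact: qn1. Qed.

Let qS_neq0 n : qpoch q S n != 0.
Proof. by apply/prodf_neq0 => i _; exact: Sn1. Qed.

Lemma WcoefSr l m : Wcoef q T S l m.+1 =
  Wcoef q T S l m * ((1 - S / T * q ^+ m) * (1 - q * q ^+ (l + m))
                     / ((1 - S * q ^+ (l + m)) * (1 - q * q ^+ m))).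
Proof.
rewrite /Wcoef addnS !qpochS.
move: (qq_neq0 l) (qq_neq0 m) (qS_neq0 (l + m)) (qn1 m) (Sn1 (l + m)).
(* Making [S / T] an atom spares [field] the side condition [T != 0]. *)
set a := S / T; move=> *; field; by do ?[apply/andP; split].
Qed.

Lemma WcoefSl l m : Wcoef q T S l.+1 m =
  Wcoef q T S l m * (S / T * (1 - T * q ^+ l) * (1 - q * q ^+ (l + m))
                     / ((1 - S * q ^+ (l + m)) * (1 - q * q ^+ l))).
Proof.
rewrite /Wcoef addSn !qpochS exprS.
move: (qq_neq0 l) (qq_neq0 m) (qS_neq0 (l + m)) (qn1 l) (Sn1 (l + m)).
set a := S / T; move=> *; field; by do ?[apply/andP; split].
Qed.

End WcoefRecurrences.

(** Numerator of [wdual] in the variables [S = s ^+ 2] and [z = s * u]. Under [x * s = y * t] both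
    sides of the equation involve the same two values of [z]. *)
Definition wnum {F : fieldType} (q S z : F)
    (i : nat) (l : bool) (k : nat) (j : bool) : F :=
  match l, j with
  | false, false => if k == i then 1 - z * q ^+ i else 0
  | true, false => if k == i.+1 then - (z / S) * (1 - S * q ^+ i) else 0
  | false, true => if i == k.+1 then 1 - q ^+ i else 0
  | true, true => if k == i then q ^+ i - z / S else 0
  end.

Lemma wdualE {F : fieldType} (q u s : F) (i k : nat) (l j : bool) : s != 0 ->
  wdual q u s i l k j = wnum q (s ^+ 2) (s * u) i l k j / (1 - s * u).
Proof.
move=> s0; have E : s^-1 * u = s * u / s ^+ 2 by field.
by case: l; case: j; rewrite /wdual /wnum -?E ?mulNr; case: ifP; rewrite ?mul0r ?mulNr.
Qed.

Section YangBaxterNumerators.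
Variables (F : fieldType) (q t s e z : F).
Hypothesis qn1 : forall n, 1 - q * q ^+ n != 0.
Hypothesis Sn1 : forall n, 1 - s ^+ 2 * q ^+ n != 0.
Hypotheses (e0 : e != 0) (s0 : s != 0) (t0 : t != 0).

Let S0 : s ^+ 2 != 0. Proof. by rewrite expf_neq0. Qed.
Let T0 : t ^+ 2 != 0. Proof. by rewrite expf_neq0. Qed.

Let WE i j k l m := @W_Wcoef F q t s i j k l m.

(* Reduces every [Wcoef] to [Wcoef l m] and clears denominators, treating
   [q ^+ l], [q ^+ m], [q ^+ a], [s ^+ 2], [t ^+ 2] as indeterminates. *)
Local Ltac ybe_field l m a :=
  rewrite /= ?WcoefSr // ?WcoefSl // ?addSn ?addnS ?addn0;
  move: (qn1 0%N) (qn1 m) (qn1 l) (Sn1 l) (Sn1 (l + m)%N) (Sn1 (l + m).+1);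
  move: S0 T0;
  move: (Wcoef _ _ _ _ _);
  generalize (s ^+ 2) (t ^+ 2) => ? ? ?;
  rewrite ?exprS ?exprD ?expr0 ?mulr1 ?mul1r;
  generalize (q ^+ m) (q ^+ a) (q ^+ l) => *;
  field; do ?[apply/andP; split] => //.

(* The sums over [l1] of the Yang-Baxter equation with [l2], [l3] determined by
   conservation and the common denominators removed; here [e] is [eta ^+ 2] and
   [z] is [s * x = t * y]. The truncated subtractions are harmless: when one
   truncates, the corresponding weight vanishes. *)
Lemma ybe_numerators (a1 b1 : bool) (a2 a3 b2 b3 : nat) :
  (a3 + a2 + b1 = b3 + b2 + a1)%N ->
  let lhs (l1 : bool) :=
    let l2 := (b2 + l1 - b1)%N in let l3 := (b3 + a1 - l1)%N in
    W q t s a3 a2 l3 l2 * wnum q (e * s ^+ 2) (e * z) l3 l1 b3 a1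
      * wnum q (t ^+ 2) z l2 b1 b2 l1 in
  let rhs (l1 : bool) :=
    let l2 := (a2 + l1 - a1)%N in let l3 := (a3 + b1 - l1)%N in
    wnum q (e * t ^+ 2) (e * z) a2 l1 l2 a1 * wnum q (s ^+ 2) z a3 b1 l3 l1
      * W q t s l3 l2 b3 b2 in
  lhs false + lhs true = rhs false + rhs true.
Proof.
move=> cons lhs rhs; rewrite {}/lhs {}/rhs /=.
(* The cases [(a1, b1)] come in the order (1,1), (1,0), (0,1), (0,0). In each, [a3] is compared with
   [b2 - b1]: below it every [W] vanishes, at equality only one term per side can survive, and above
   it [m] is the excess minus one. *)
case: a1 b1 cons => -[] /= cons;
  rewrite ?addn0 ?addn1 ?subn0 ?subn1 /wnum /= in cons *.
(* For [b1 = 1] the left side contains [l2 = b2 - 1]; at [b2 = 0] this truncates and the weight is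
   zero. *)
- case: b2 cons => [|l] cons.
  + have {cons} -> : b3 = (a3 + a2)%N by lia.
    rewrite (WE _ _ _ 0%N a3) // !eqxx /= !(mulr0, mul0r, add0r).
    (* For [a1 = 1] the right side contains [l2 = a2 - 1], again with zero weight at [a2 = 0]. *)
    case: a2 => [|a2] /=.
      rewrite addn0 !(mulr0, mul0r, add0r).
      by ybe_field 0%N a3 0%N.
    rewrite (WE _ _ _ 0%N a3.+1) ?addSnnS // !addnS eqxx.
    by ybe_field 0%N a3 a2.
  + case: (ltngtP a3 l) => [lt3l|gt3l|eq3l].
    * by rewrite !W_gt ?(mulr0, mul0r) //; lia.
    * have [m a3E] : exists m, a3 = (l + m.+1)%N by exists (a3 - l).-1; lia.
      have -> : b3 = (m + a2)%N by lia.
      subst a3; rewrite (WE (l + m.+1)%N _ _ l m.+1) ?(WE (l + m.+1)%N _ _ l.+1 m) ?eqxx; try lia.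
      case: a2 cons => [|a2] cons /=.
        rewrite !(mulr0, mul0r, add0r) addn0.
        by ybe_field l m 0%N.
      rewrite (WE (l + m.+1).+1 _ _ l.+1 m.+1) ?eqxx; try lia.
      by ybe_field l m a2.
    * subst a3; have -> : a2 = b3.+1 by lia.
      rewrite (WE l _ _ l 0%N) ?(WE l.+1 _ _ l.+1 0%N) ?W_gt ?eqxx; try lia.
      by ybe_field l 0%N b3.
- case: (ltngtP a3 b2) => [lt32|gt32|eq32].
  + by rewrite !W_gt ?(mulr0, mul0r) //; lia.
  + have [m a3E] : exists m, a3 = (b2 + m.+1)%N by exists (a3 - b2).-1; lia.
    have -> : b3 = (m + a2)%N by lia.
    subst a3; case: a2 cons => [|a2] cons;
      rewrite !addnS /= !eqxx ?(mulr0, mul0r, add0r) ?addn0;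
      rewrite !(WE (b2 + m).+1 _ _ b2 m.+1) ?(WE (b2 + m).+1 _ _ b2.+1 m);
      rewrite ?(WE (b2 + m)%N _ _ b2 m); try lia.
      by ybe_field b2 m 0%N.
    by ybe_field b2 m a2.
  + subst a3; have -> : a2 = b3.+1 by lia.
    rewrite !(WE b2 _ _ b2 0%N) ?eqxx ?addn0 //.
    rewrite (@W_gt _ _ _ _ b2) //.
    (* The term with [l3 = b2 - 1] dies for two reasons: its dual weight vanishes if [b2 = 0], and
       [W] vanishes otherwise since [l3 < b2]. *)
    case: b2 {cons} => [|l] /=; rewrite ?(mulr0, mul0r) ?eqxx ?W_gt //.
      by ybe_field 0%N 0%N b3.
    by ybe_field l 0%N b3.
- case: b2 cons => [|l] cons.
  + have {cons} -> : b3 = (a3 + a2).+1%N by lia.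
    rewrite /= !eqxx !(mulr0, mul0r, add0r).
    rewrite !(WE a3 _ _ 0%N a3) ?(WE a3.+1 _ _ 0%N a3.+1) ?addnS //.
    by ybe_field 0%N a3 a2.
  + case: (ltngtP a3 l) => [lt3l|gt3l|eq3l].
    * by rewrite !W_gt ?(mulr0, mul0r) //; lia.
    * have [m a3E] : exists m, a3 = (l + m.+1)%N by exists (a3 - l).-1; lia.
      have -> : b3 = (m + a2).+1%N by lia.
      subst a3; rewrite (WE (l + m.+1)%N _ _ l m.+1) ?(WE (l + m.+1)%N _ _ l.+1 m) ?eqxx; try lia.
      rewrite (WE (l + m.+1).+1 _ _ l.+1 m.+1) ?(WE (l + m.+1)%N _ _ l.+1 m) ?eqxx; try lia.
      by ybe_field l m a2.
    * subst a3; have -> : b3 = a2 by lia.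
      rewrite (WE _ _ _ l 0%N) ?(WE l.+1 _ _ l.+1 0%N) ?W_gt ?eqxx ?addn0 //; try lia.
      by ybe_field l 0%N a2.
- case: (ltngtP a3 b2) => [lt32|gt32|eq32].
  + by rewrite !W_gt ?(mulr0, mul0r) //; lia.
  + have [m a3E] : exists m, a3 = (b2 + m.+1)%N by exists (a3 - b2).-1; lia.
    have -> : b3 = (m + a2).+1 by lia.
    subst a3; rewrite !addnS /= !eqxx.
    rewrite !(WE (b2 + m).+1 _ _ b2 m.+1) ?(WE (b2 + m).+1 _ _ b2.+1 m);
    rewrite ?(WE (b2 + m)%N _ _ b2 m); try lia.
    by ybe_field b2 m a2.
  + subst a3; have -> : b3 = a2 by lia.
    rewrite (WE b2 _ _ b2 0%N) ?eqxx ?addn0 // (@W_gt _ _ _ _ b2) //.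
    case: b2 {cons} => [|l] /=; rewrite ?(mulr0, mul0r) ?eqxx ?W_gt //.
      by ybe_field 0%N 0%N a2.
    by ybe_field l 0%N a2.
Qed.

End YangBaxterNumerators.

Theorem proposition3p2 (F : fieldType) (q eta x y s t : F)
  (q_generic : forall n : nat, (0 < n)%N -> q ^+ n != 1)
  (eta_neq0 : eta != 0) (s_neq0 : s != 0) (t_neq0 : t != 0)
  (s_generic : forall n : nat, s ^+ 2 * q ^+ n != 1)
  (sx_neq1 : s * x != 1) (eta_sx_neq1 : (eta * s) * (eta * x) != 1)
  (xs_yt : x * s = y * t)
  (a1 b1 : bool) (a2 a3 b2 b3 : nat) :
  \sum_(l \in [set: bool * nat * nat])
    (let: (l1, l2, l3) := l in
     W q t s a3 a2 l3 l2 * wdual q (eta * x) (eta * s) l3 l1 b3 a1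
       * wdual q y t l2 b1 b2 l1)
  = \sum_(l \in [set: bool * nat * nat])
    (let: (l1, l2, l3) := l in
     wdual q (eta * y) (eta * t) a2 l1 l2 a1 * wdual q x s a3 b1 l3 l1
       * W q t s l3 l2 b3 b2).
Proof.
(* The three local conservation laws add up to this global one; if it fails, every term on both
   sides is zero. *)
have [cons|ncons] := eqVneq (a3 + a2 + b1)%N (b3 + b2 + a1)%N; last first.
  rewrite !fsbig1 // => -[[l1 l2] l3] _; apply: contraNeq ncons;
    rewrite !mulf_eq0 !negb_or.
    by case/andP=> /andP[/wdual_conserve h1 /wdual_conserve h2] /W_conserve h3;
      apply/eqP; lia.
  by case/andP=> /andP[/W_conserve h1 /wdual_conserve h2] /wdual_conserve h3;
    apply/eqP; lia.
rewrite (@fsum_two_points _ (fun l1 => b2 + l1 - b1)%N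
                            (fun l1 => b3 + a1 - l1)%N); last first.
  move=> l1 l2 l3; rewrite !mulf_eq0 !negb_or.
  by case/andP=> /andP[/W_conserve h1 /wdual_conserve h2] /wdual_conserve h3; lia.
rewrite (@fsum_two_points _ (fun l1 => a2 + l1 - a1)%N
                            (fun l1 => a3 + b1 - l1)%N); last first.
  move=> l1 l2 l3; rewrite !mulf_eq0 !negb_or.
  by case/andP=> /andP[/wdual_conserve h1 /wdual_conserve h2] /W_conserve h3; lia.
have ty : t * y = s * x by rewrite mulrC -xs_yt mulrC.
have eta2_neq0 : eta ^+ 2 != 0 by rewrite expf_neq0.
have qn1 n : 1 - q * q ^+ n != 0 by rewrite -exprS subr_eq0 eq_sym q_generic.
have Sn1 n : 1 - s ^+ 2 * q ^+ n != 0 by rewrite subr_eq0 eq_sym.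
have := @ybe_numerators F q t s (eta ^+ 2) (s * x) qn1 Sn1
  eta2_neq0 s_neq0 t_neq0 a1 b1 a2 a3 b2 b3 cons.
rewrite !wdualE ?mulf_neq0 // !(mulrACA eta _ eta) -expr2 ty !exprMn => E.
(* All four products now carry the same two denominators, which are moved outside the sums to reach
   [E]. *)
have frac w m n c d : w * (m / c) * (n / d) = w * m * n / (c * d) :> F.
  by rewrite invfM; ring.
have frac' w m n c d : m / c * (n / d) * w = m * n * w / (c * d) :> F.
  by rewrite invfM; ring.
by rewrite !frac !frac' -!mulrDl E.
Qed.
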